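(* Let $(M,\mathcal Z,g)$ be an $\alpha$-Grushin manifold of dimension $n+1$ with $\alpha>-1$ and compact singular set $\mathcal Z$. Then its scalar curvature $S$ satisfies $$S=-\frac{\alpha n(\alpha n+\alpha+2)}{x^2}+o(|x|^{-2}),\qquad x\to 0,$$ where $x$ is the (signed) distance to $\mathcal Z$.
   Context: An $\alpha$-Grushin manifold ($\alpha\in\mathbb R$) is a triple $(M,\mathcal Z,g)$ consisting of a smooth manifold $M$ of dimension $n+1$ ($n\ge 1$), a co-orientable embedded submanifold $\mathcal Z\subset M$ of codimension one (the singular set), and a Riemannian metric $g$ on $M\setminus\mathcal Z$ which in a tubular neighbourhood of $\mathcal Z$, identified with $(-\varepsilon,\varepsilon)_x\times\mathcal Z$, takes the form $g=dx^2+|x|^{-2\alpha}g_{x,\mathcal Z}$, where $g_{x,\mathcal Z}$ is a family of Riemannian metrics on the level sets $x=\mathrm{const}$ (identified with $\mathcal Z$), depending smoothly on $x$ up to and across $x=0$, and $x$ is the signed distance to $\mathcal Z$. $S$ denotes the scalar curvature of $g$ on $M\setminus\mathcal Z$. *)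

(* Defs.v *)
From HB Require Import structures.
From mathcomp Require Import all_boot all_order all_algebra.
From mathcomp Require Import all_classical all_reals all_analysis.

Set Implicit Arguments.
Unset Strict Implicit.
Unset Printing Implicit Defensive.

Import Order.TTheory GRing.Theory Num.Theory.
Import numFieldNormedType.Exports.

Local Open Scope classical_set_scope.
Local Open Scope ring_scope.

Section SmoothFunctions.
Variable R : realType.

(* i-th partial derivative; [delta_mx 0 i] is the i-th standard basis vector. *)
Definition partial (d : nat) (i : 'I_d) (f : 'rV[R]_d -> R) : 'rV[R]_d -> R :=
  fun u => 'D_(delta_mx 0 i) f u.

(* Meant for open [U] only: continuity and derivability are not relative. *)
Fixpoint Ck (d k : nat) (U : set 'rV[R]_d) (f : 'rV[R]_d -> R) : Prop :=
  (forall u, U u -> {for u, continuous f}) /\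
  if k is k'.+1 then
    forall i : 'I_d, (forall u, U u -> derivable f u (delta_mx 0 i)) /\
                     Ck k' U (partial i f)
  else True.

Definition smooth_on (d : nat) (U : set 'rV[R]_d) (f : 'rV[R]_d -> R) : Prop :=
  forall k, Ck k U f.

Definition smooth_map_on (d m : nat) (U : set 'rV[R]_d)
    (f : 'rV[R]_d -> 'rV[R]_m) : Prop :=
  forall j : 'I_m, smooth_on U (fun u => f u 0 j).

End SmoothFunctions.

Section Manifolds.
Variable R : realType.

(* Outside [dom c], respectively [chart_image c], the functions [coord c] and
   [param c] take arbitrary values. *)
Record chart (d : nat) (T : topologicalType) := Chart {
  dom : set T;
  coord : T -> 'rV[R]_d;
  param : 'rV[R]_d -> T;
  dom_open : open dom;
  image_open : open (coord @` dom);
  coordK : forall p, dom p -> param (coord p) = p;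
  coord_continuous : forall p, dom p -> {for p, continuous coord};
  param_continuous : forall u, (coord @` dom) u -> {for u, continuous param}
}.

Definition chart_image (d : nat) (T : topologicalType) (c : chart d T) :
  set 'rV[R]_d := coord c @` dom c.

Definition transition (d : nat) (T : topologicalType) (c c' : chart d T) :
  'rV[R]_d -> 'rV[R]_d := coord c' \o param c.

Definition compatible (d : nat) (T : topologicalType) (c c' : chart d T) :=
  smooth_map_on (coord c @` (dom c `&` dom c')) (transition c c') /\
  smooth_map_on (coord c' @` (dom c `&` dom c')) (transition c' c).

Record smoothManifold (d : nat) := SmoothManifold {
  points :> topologicalType;
  points_hausdorff : hausdorff_space points;
  points_second_countable : @second_countable points;
  atlas : set (chart d points);
  atlas_cover : forall p, exists2 c, atlas c & dom c p;
  atlas_compatible : forall c c', atlas c -> atlas c' -> compatible c c';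
  atlas_maximal :
    forall c, (forall c', atlas c' -> compatible c c') -> atlas c
}.

Arguments atlas {d} _ _.

(* A symmetric positive definite covariant 2-tensor field on the open set [A],
   given by its matrix [g c p] at [p] in every chart [c] around [p].  Tangent
   vectors are rows and ['J f u] acts on them from the right, whence the form
   [J *m _ *m J^T] of the transformation law. *)
Definition riemannian_metric (d : nat) (M : smoothManifold d) (A : set M)
    (g : chart d M -> M -> 'M[R]_d) : Prop :=
  [/\ forall c p, atlas M c -> dom c p -> A p ->
        (g c p)^T = g c p /\
        (forall v : 'rV[R]_d, v != 0 -> 0 < (v *m g c p *m v^T) 0 0),
      forall c (i j : 'I_d), atlas M c ->
        smooth_on (coord c @` (dom c `&` A)) (fun u => g c (param c u) i j)
    & forall c c' p, atlas M c -> atlas M c' -> dom c p -> dom c' p -> A p ->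
        g c p = 'J (transition c c') (coord c p) *m g c' p *m
                ('J (transition c c') (coord c p))^T].

Definition smooth_map (d m : nat) (N : smoothManifold d) (M : smoothManifold m)
    (f : N -> M) : Prop :=
  continuous f /\
  forall b c, atlas N b -> atlas M c ->
    smooth_map_on (coord b @` (dom b `&` f @^-1` dom c))
                  (coord c \o f \o param b).

Definition local_jacobian (d m : nat) (N : smoothManifold d)
    (M : smoothManifold m) (f : N -> M) (b : chart d N) (c : chart m M)
    (z : N) : 'M[R]_(d, m) :=
  'J (coord c \o f \o param b) (coord b z).

Definition smooth_embedding (d m : nat) (N : smoothManifold d)
    (M : smoothManifold m) (f : N -> M) : Prop :=
  [/\ smooth_map f,
      forall b c z, atlas N b -> atlas M c -> dom b z -> dom c (f z) ->
        row_free (local_jacobian f b c z),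
      injective f
    & forall V : set N, open V ->
        exists2 W : set M, open W & f @` V = W `&` range f].

(* Existence of a continuous field of tangent vectors of [M] along [f] which is
   nowhere tangent to [f], i.e. of a nowhere vanishing section of the normal
   bundle (a line bundle when [f] has codimension one).  [v c z] is the row of
   components in the chart [c] of the vector at [f z]. *)
Definition coorientable (d m : nat) (N : smoothManifold d)
    (M : smoothManifold m) (f : N -> M) : Prop :=
  exists v : chart m M -> N -> 'rV[R]_m,
  [/\ forall c z, atlas M c -> dom c (f z) -> {for z, continuous (v c)},
      forall c c' z, atlas M c -> atlas M c' -> dom c (f z) -> dom c' (f z) ->
        v c' z = v c z *m 'J (transition c c') (coord c (f z))
    & forall b c z, atlas N b -> atlas M c -> dom b z -> dom c (f z) ->
        ~~ (v c z <= local_jacobian f b c z)%MS].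

End Manifolds.

Arguments atlas {R d} _ _.

Section Curvature.
Variables (R : realType) (d : nat).

(* Curvature of a metric [G] given in coordinates, with the sign convention for
   which round spheres have positive scalar curvature. *)
Implicit Type G : 'rV[R]_d -> 'M[R]_d.

(* Gamma^k_ij *)
Definition christoffel G (k i j : 'I_d) (u : 'rV[R]_d) : R :=
  2^-1 * \sum_(l < d) invmx (G u) k l *
    (partial i (fun w => G w j l) u + partial j (fun w => G w i l) u
     - partial l (fun w => G w i j) u).

(* R^l_kij, the dx^l-component of R(e_i, e_j) e_k, where R(X, Y) is
   [nabla_X, nabla_Y] - nabla_[X, Y] *)
Definition riemann G (l k i j : 'I_d) (u : 'rV[R]_d) : R :=
  partial i (christoffel G l j k) u - partial j (christoffel G l i k) u +
  \sum_(m < d) (christoffel G l i m u * christoffel G m j k u -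
                christoffel G l j m u * christoffel G m i k u).

(* Ric(e_j, e_k) is the trace of X |-> R(X, e_j) e_k *)
Definition ricci G (j k : 'I_d) (u : 'rV[R]_d) : R :=
  \sum_(i < d) riemann G i k i j u.

Definition scal G (u : 'rV[R]_d) : R :=
  \sum_(j < d) \sum_(k < d) invmx (G u) j k * ricci G j k u.

(* [S] is the scalar curvature of [g] on [A].  As [scal] is invariant under
   changes of coordinates and every point lies in some chart, this determines
   [S] on [A]; the values of [S] outside [A] are arbitrary. *)
Definition scalar_curvature (M : smoothManifold R d) (A : set M)
    (g : chart R d M -> M -> 'M[R]_d) (S : M -> R) : Prop :=
  forall c p, atlas M c -> dom c p -> A p ->
    S p = scal (fun u => g c (param c u)) (coord c p).

End Curvature.

Section Distance.
Variables (R : realType) (d : nat) (M : smoothManifold R d).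
Variables (g : chart R d M -> M -> 'M[R]_d) (Z : set M).

(* Curves parametrised by [0, 1] from [p] to a point of [Z], meeting [Z] in no
   interior time, and C^1 in the open interval. *)
Definition curve_to (p : M) (gamma : R -> M) : Prop :=
  [/\ gamma 0 = p, Z (gamma 1), {within `[0, 1], continuous gamma},
      forall t, t \in `]0, 1[ -> ~ Z (gamma t)
    & forall t c, t \in `]0, 1[ -> atlas M c -> dom c (gamma t) ->
        derivable (coord c \o gamma) t 1 /\
        {for t, continuous (derive1 (coord c \o gamma))}].

(* [s] is the g-norm of the velocity of [gamma]; it is independent of the
   chart. *)
Definition is_speed (gamma : R -> M) (s : R -> R) : Prop :=
  forall t c, t \in `]0, 1[ -> atlas M c -> dom c (gamma t) ->
    let v : 'rV[R]_d := derive1 (coord c \o gamma) t in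
    s t = Num.sqrt ((v *m g c (gamma t) *m v^T) 0 0).

Definition distance_to (p : M) : \bar R :=
  ereal_inf [set l | exists gamma s,
    [/\ curve_to p gamma, is_speed gamma s
      & l = (\int[lebesgue_measure]_(t in `]0%R, 1%R[) (s t)%:E)%E]].

End Distance.

Section Grushin.
Variable R : realType.

(* [c] is the chart (id x b) o tube^-1 on tube ((-r, r) x dom b). *)
Definition tube_chart (n : nat) (M : smoothManifold R (1 + n))
    (Z : smoothManifold R n) (tube : R -> Z -> M) (r : R)
    (b : chart R n Z) (c : chart R (1 + n) M) : Prop :=
  dom c = [set p | exists x z, [/\ `|x| < r, dom b z & p = tube x z]] /\
  (forall x z, `|x| < r -> dom b z ->
    coord c (tube x z) = row_mx x%:M (coord b z)).

(* The singular set is the image of the embedding [emb] of [singular].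
   Restricted to (-radius, radius) x singular, [tube] is a tubular
   neighbourhood of it, i.e. a diffeomorphism onto an open subset of [ambient]
   extending [emb]: it is injective and ([tube_diffeo]) carries the product
   charts id x b to charts of the smooth structure of [ambient].
   [slice x] is the metric g_{x,Z}. *)
Record grushinManifold (n : nat) (alpha : R) := GrushinManifold {
  ambient : smoothManifold R (1 + n);
  singular : smoothManifold R n;
  emb : singular -> ambient;
  emb_embedding : smooth_embedding emb;
  emb_coorientable : coorientable emb;
  gmetric : chart R (1 + n) ambient -> ambient -> 'M[R]_(1 + n);
  gmetric_riemannian : riemannian_metric (~` range emb) gmetric;
  radius : R;
  radius_gt0 : 0 < radius;
  tube : R -> singular -> ambient;
  tube0 : forall z, tube 0 z = emb z;
  tube_inj : forall x x' z z', `|x| < radius -> `|x'| < radius ->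
    tube x z = tube x' z' -> x = x' /\ z = z';
  tube_diffeo : forall b, atlas singular b ->
    exists2 c, atlas ambient c & tube_chart tube radius b c;
  slice : R -> chart R n singular -> singular -> 'M[R]_n;
  slice_riemannian : forall x, `|x| < radius ->
    riemannian_metric [set: singular] (slice x);
  (* joint smoothness in x, across 0, and in the point of [singular] *)
  slice_smooth : forall b (i j : 'I_n), atlas singular b ->
    smooth_on [set u : 'rV[R]_(1 + n) | `|lsubmx u 0 0| < radius /\
                                        chart_image b (rsubmx u)]
      (fun u => slice (lsubmx u 0 0) b (param b (rsubmx u)) i j);
  (* g = dx^2 + |x|^(-2 alpha) g_{x,Z}, in the coordinates (x, b) *)
  gmetric_tube : forall b c, atlas singular b -> atlas ambient c ->
    tube_chart tube radius b c ->
    forall x z, x != 0 -> `|x| < radius -> dom b z ->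
    gmetric c (tube x z) =
      block_mx 1%:M 0 0 ((`|x| `^ (- (2 * alpha))) *: slice x b z);
  (* x is the distance to the singular set, signed by the side of the tube *)
  tube_distance : forall x z, x != 0 -> `|x| < radius ->
    distance_to gmetric (range emb) (tube x z) = `|x|%:E
}.

(* The filter "x -> 0, x != 0, uniformly in the point of the singular set". *)
Definition near_singular (n : nat) (alpha : R) (X : grushinManifold n alpha) :
    filter_on (R * singular X) :=
  FilterType (filter_prod (0 : R)^' (globally [set: singular X])) _.

End Grushin.

Arguments emb {R n alpha} _ _.
Arguments gmetric {R n alpha} _ _ _.
Arguments tube {R n alpha} _ _ _.
Arguments near_singular {R n alpha} X.

(* Main.v *)
(* In the coordinates (x, y) of a tube over a chart of Z the metric is
   dx^2 + phi h with phi = |x|^(-2 alpha), where h = h(x, y) is smooth and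
   positive definite also across x = 0.  Set psi = phi' / phi = -2 alpha / x and
   B = h^-1 (d_x h) / 2.  The scalar curvature of such a metric is
     - n psi' - (n + n^2) / 4 psi^2 - (1 + n) psi tr B + b + S_h / phi
   where b and the intrinsic scalar curvature S_h of the slices are built from h
   and its derivatives, hence are smooth across x = 0.  The first two
   terms are the main term of the expansion; multiplied by x^2, the others are
   bounded by a multiple of |x| + x^2 + |x|^(2 alpha + 2), locally uniformly in
   y, and so uniformly on the compact Z. *)
Require Import Defs.
From HB Require Import structures.
From mathcomp Require Import all_boot all_order all_algebra.
From mathcomp Require Import all_classical all_reals all_analysis.
From mathcomp Require Import ring lra.

Import Order.TTheory GRing.Theory Num.Theory.
Import numFieldNormedType.Exports.

Local Open Scope classical_set_scope.
Local Open Scope ring_scope.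

Set Implicit Arguments.
Unset Strict Implicit.

(** * Calculus of smooth functions on open sets of row vectors *)
Section SmoothCalculus.
Variables (R : realType) (d : nat).
Implicit Types (U : set 'rV[R]_d) (f g : 'rV[R]_d -> R) (i : 'I_d) (k : nat).

Lemma eq_partial U f g i (u : 'rV[R]_d) : open U -> (forall w, U w -> f w = g w) ->
  U u -> partial i f u = partial i g u.
Proof.
move=> oU fg Uu; apply: near_eq_derive.
by apply: filterS (open_nbhs_nbhs (conj oU Uu)).
Qed.

Lemma Ck_continuous k U f u : Ck k U f -> U u -> {for u, continuous f}.
Proof. by case: k => [|k] [+ _]; exact. Qed.

Lemma Ck_derivable k U f i u : Ck k.+1 U f -> U u ->
  derivable f u (delta_mx 0 i).
Proof. by move=> [_ /(_ i)[+ _]]; exact. Qed.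

Lemma CkW k U f : Ck k.+1 U f -> Ck k U f.
Proof.
elim: k f => [|k IH] f; first by case.
move=> [cf H]; split=> // i; have [df /IH Cf] := H i.
by split.
Qed.

Lemma open_near_eq U f g u : open U -> (forall w, U w -> f w = g w) ->
  U u -> \near u, f u = g u.
Proof.
by move=> oU fg Uu; apply: filterS (open_nbhs_nbhs (conj oU Uu)) => w; exact: fg.
Qed.

Lemma eq_continuous_at U f g (u : 'rV[R]_d) : open U ->
  (forall w, U w -> f w = g w) -> U u ->
  {for u, continuous f} -> {for u, continuous g}.
Proof.
move=> oU fg Uu cf; rewrite /prop_for /continuous_at -(fg u Uu).
have gf : g @ nbhs u --> f @ nbhs u.
  by apply: near_eq_cvg; exact: open_near_eq fg Uu.
exact: cvg_trans gf cf.
Qed.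

(** Partial derivatives see only germs, so on an open [U] agreement on [U] passes to derivatives of
    every order. The formulas for partial derivatives, valid only on [U], enter the inductions on
    [k] this way. *)
Lemma eq_Ck k U f g : open U -> (forall w, U w -> f w = g w) ->
  Ck k U f -> Ck k U g.
Proof.
move=> oU; elim: k f g => [|k IH] f g fg [cf H]; split=> //.
- by move=> u Uu; exact: eq_continuous_at fg Uu (cf u Uu).
- by move=> u Uu; exact: eq_continuous_at fg Uu (cf u Uu).
move=> i; have [df Cf] := H i; split=> [u Uu|].
  by apply: near_eq_derivable (df u Uu); exact: open_near_eq fg Uu.
by apply: IH Cf => w Uw; exact: eq_partial fg Uw.
Qed.

Lemma partialD f g i u :
  derivable f u (delta_mx 0 i) -> derivable g u (delta_mx 0 i) ->
  partial i (fun w => f w + g w) u = partial i f u + partial i g u.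
Proof. exact: deriveD. Qed.

Lemma partialM f g i u :
  derivable f u (delta_mx 0 i) -> derivable g u (delta_mx 0 i) ->
  partial i (fun w => f w * g w) u = f u * partial i g u + g u * partial i f u.
Proof. exact: deriveM. Qed.

Lemma derivable_mul f g i u :
  derivable f u (delta_mx 0 i) -> derivable g u (delta_mx 0 i) ->
  derivable (fun w => f w * g w) u (delta_mx 0 i).
Proof. exact: derivableM. Qed.

Lemma derivable_add f g i u :
  derivable f u (delta_mx 0 i) -> derivable g u (delta_mx 0 i) ->
  derivable (fun w => f w + g w) u (delta_mx 0 i).
Proof. exact: derivableD. Qed.

Lemma partial_cst (a : R) i u : partial i (fun=> a) u = 0.
Proof. exact: derive_cst. Qed.

Lemma partialZ (a : R) f i u : derivable f u (delta_mx 0 i) ->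
  partial i (fun w => a * f w) u = a * partial i f u.
Proof. exact: deriveZ. Qed.

Lemma Ck_cst k U (a : R) : Ck k U (fun=> a).
Proof.
elim: k a => [|k IH] a; split=> //; try by move=> u _; exact: cst_continuous.
move=> i; split=> [u _|]; first exact: derivable_cst.
have -> : partial i (fun=> a) = (fun=> 0 : R) by apply/funext => w; exact: partial_cst.
exact: IH.
Qed.

Lemma CkD k U f g : open U -> Ck k U f -> Ck k U g ->
  Ck k U (fun w => f w + g w).
Proof.
move=> oU; elim: k f g => [|k IH] f g Cf Cg; split=> //.
- by move=> u Uu; apply: continuousD; [exact: Ck_continuous Cf _|exact: Ck_continuous Cg _].
- by move=> u Uu; apply: continuousD; [exact: Ck_continuous Cf _|exact: Ck_continuous Cg _].
move=> i; split=> [u Uu|].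
  by apply: derivableD; [exact: Ck_derivable Cf _|exact: Ck_derivable Cg _].
apply: eq_Ck (IH _ _ (Cf.2 i).2 (Cg.2 i).2) => // w Uw.
by rewrite partialD//; [exact: Ck_derivable Cf _|exact: Ck_derivable Cg _].
Qed.

Lemma CkM k U f g : open U -> Ck k U f -> Ck k U g ->
  Ck k U (fun w => f w * g w).
Proof.
move=> oU; elim: k f g => [|k IH] f g Cf Cg; split=> //.
- by move=> u Uu; apply: continuousM; [exact: Ck_continuous Cf _|exact: Ck_continuous Cg _].
- by move=> u Uu; apply: continuousM; [exact: Ck_continuous Cf _|exact: Ck_continuous Cg _].
move=> i; split=> [u Uu|].
  by apply: derivableM; [exact: Ck_derivable Cf _|exact: Ck_derivable Cg _].
(* Leibniz rule: the differentiated factor has lost one order already, and [CkW] lowers the other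
   factor to match. *)
apply: eq_Ck (CkD oU (IH _ _ (CkW Cf) (Cg.2 i).2)
  (IH _ _ (CkW Cg) (Cf.2 i).2)) => // w Uw.
by rewrite partialM//; [exact: Ck_derivable Cf _|exact: Ck_derivable Cg _].
Qed.

Lemma CkV k U f : open U -> (forall u, U u -> f u != 0) -> Ck k U f ->
  Ck k U (fun w => (f w)^-1).
Proof.
move=> oU f0; elim: k => [|k IH] Cf; split=> //.
- by move=> u Uu; apply: continuousV; [exact: f0|exact: Ck_continuous Cf _].
- by move=> u Uu; apply: continuousV; [exact: f0|exact: Ck_continuous Cf _].
move=> i; split=> [u Uu|].
  by apply: derivableV; [exact: f0|exact: Ck_derivable Cf _].
have IHf := IH (CkW Cf).
(* The derivative of [f^-1] is [- (f^-1)^2] times that of [f]; one order lower, [f^-1] is covered by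
   the induction hypothesis. *)
apply: eq_Ck (CkM oU (Ck_cst k U (-1))
  (CkM oU (CkM oU IHf IHf) (Cf.2 i).2)) => // w Uw.
rewrite /partial deriveV; [|exact: f0|exact: Ck_derivable Cf _].
by rewrite -[in RHS]exprVn /GRing.scale/= expr2 mulN1r mulNr.
Qed.

Lemma smooth_partial U f i : smooth_on U f -> smooth_on U (partial i f).
Proof. by move=> sf k; have [] := (sf k.+1).2 i. Qed.

Lemma smooth_derivable U f i u : smooth_on U f -> U u ->
  derivable f u (delta_mx 0 i).
Proof. by move=> sf; exact: Ck_derivable (sf 1%N). Qed.

Lemma smooth_continuous U f u : smooth_on U f -> U u -> {for u, continuous f}.
Proof. by move=> sf; exact: Ck_continuous (sf 0%N). Qed.

Lemma smooth_subset U (V : set 'rV[R]_d) f : V `<=` U -> smooth_on U f ->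
  smooth_on V f.
Proof.
move=> VU sf k; move: f {sf} (sf k); elim: k => [|k IH] f [cf H]; split=> //.
- by move=> u /VU; exact: cf.
- by move=> u /VU; exact: cf.
move=> i; have [df Cf] := H i; split; last exact: IH.
by move=> u /VU; exact: df.
Qed.

Lemma eq_smooth U f g : open U -> (forall w, U w -> f w = g w) ->
  smooth_on U f -> smooth_on U g.
Proof. by move=> oU fg sf k; exact: eq_Ck fg (sf k). Qed.

Lemma smooth_cst U (a : R) : smooth_on U (fun=> a).
Proof. by move=> k; exact: Ck_cst. Qed.

Lemma smoothD U f g : open U -> smooth_on U f -> smooth_on U g ->
  smooth_on U (fun w => f w + g w).
Proof. by move=> oU sf sg k; exact: CkD. Qed.

Lemma smoothM U f g : open U -> smooth_on U f -> smooth_on U g ->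
  smooth_on U (fun w => f w * g w).
Proof. by move=> oU sf sg k; exact: CkM. Qed.

Lemma smoothN U f : open U -> smooth_on U f -> smooth_on U (fun w => - f w).
Proof.
move=> oU sf; apply: eq_smooth (smoothM oU (smooth_cst U (-1)) sf) => // w _.
by rewrite mulN1r.
Qed.

Lemma smoothV U f : open U -> (forall u, U u -> f u != 0) -> smooth_on U f ->
  smooth_on U (fun w => (f w)^-1).
Proof. by move=> oU f0 sf k; exact: CkV. Qed.

Lemma smooth_sum U (I : Type) (r : seq I) (F : I -> 'rV[R]_d -> R) :
  open U -> (forall j, smooth_on U (F j)) ->
  smooth_on U (fun w => \sum_(j <- r) F j w).
Proof.
move=> oU sF; elim: r => [|j r IH].
  by apply: eq_smooth (smooth_cst U 0) => // w _; rewrite big_nil.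
by apply: eq_smooth (smoothD oU (sF j) IH) => // w _; rewrite big_cons.
Qed.

Lemma smooth_prod U (I : Type) (r : seq I) (F : I -> 'rV[R]_d -> R) :
  open U -> (forall j, smooth_on U (F j)) ->
  smooth_on U (fun w => \prod_(j <- r) F j w).
Proof.
move=> oU sF; elim: r => [|j r IH].
  by apply: eq_smooth (smooth_cst U 1) => // w _; rewrite big_nil.
by apply: eq_smooth (smoothM oU (sF j) IH) => // w _; rewrite big_cons.
Qed.

Lemma smooth_det U n (A : 'rV[R]_d -> 'M[R]_n) : open U ->
  (forall i j : 'I_n, smooth_on U (fun w => A w i j)) ->
  smooth_on U (fun w => \det (A w)).
Proof.
move=> oU sA; apply: smooth_sum => // s.
by apply: smoothM => //; [exact: smooth_cst|exact: smooth_prod].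
Qed.

(** Cramer's formula: an entry of the inverse is a cofactor, polynomial in the entries, divided by
    the nonvanishing determinant. *)
Lemma smooth_invmx U n (A : 'rV[R]_d -> 'M[R]_n) (i j : 'I_n) : open U ->
  (forall w, U w -> A w \in unitmx) ->
  (forall i j : 'I_n, smooth_on U (fun w => A w i j)) ->
  smooth_on U (fun w => invmx (A w) i j).
Proof.
move=> oU uA sA.
have sV : smooth_on U (fun w => (\det (A w))^-1).
  apply: smoothV => //; last exact: smooth_det.
  by move=> u /uA; rewrite unitmxE unitfE.
have sC : smooth_on U (fun w => cofactor (A w) j i).
  apply: smoothM => //; first exact: smooth_cst.
  apply: smooth_det => // a b; apply: eq_smooth (sA (lift j a) (lift i b)) => //.
  by move=> w _; rewrite !mxE.
apply: eq_smooth (smoothM oU sV sC) => // w /uA Aw.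
by rewrite /invmx Aw !mxE.
Qed.

(** The difference quotient along the i-th basis vector is literally that of [f] in one variable. *)
Lemma is_derive_coord (f : R -> R) (df : R) i (u : 'rV[R]_d) :
  is_derive (u 0 i) 1 f df ->
  is_derive u (delta_mx 0 i) (fun w : 'rV[R]_d => f (w 0 i)) df.
Proof.
move=> [dvf fE].
have E : (fun h => h^-1 *: (f ((h *: delta_mx 0 i + u) 0 i) - f (u 0 i))) =
         (fun h => h^-1 *: (f (h *: 1 + u 0 i) - f (u 0 i))).
  by apply/funext => h; rewrite !mxE !eqxx.
by split; [move: dvf; rewrite /derivable /= -E|rewrite -fE /derive/= -E].
Qed.

Lemma is_derive_coord_ne (f : R -> R) i j (u : 'rV[R]_d) : j != i ->
  is_derive u (delta_mx 0 i) (fun w : 'rV[R]_d => f (w 0 j)) 0.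
Proof.
move=> ji.
have E : (fun h => h^-1 *: (f ((h *: delta_mx 0 i + u) 0 j) - f (u 0 j))) =
         (fun h : R => h^-1 *: (cst 0 (h *: delta_mx 0 i + u) - cst 0 u : R)).
  apply/funext => h; rewrite !mxE (negbTE ji) andbF mulr0 add0r.
  by rewrite subrr subr0.
split; first by rewrite /derivable /= E; exact: (derivable_cst (0 : R) u (delta_mx 0 i)).
by rewrite /derive/= E; exact: (derive_cst (0 : R) u (delta_mx 0 i)).
Qed.

End SmoothCalculus.

(** * Scalar curvature of dx^2 + K(x, y) *)
Section Tangential.
Variables (R : realType) (n : nat).
Implicit Types (H K : 'rV[R]_(1 + n) -> 'M[R]_n).

(** [o] is the index of the normal coordinate x; [t a] is that of the a-th coordinate along the
    slices. *)
Local Notation o := (lshift n (ord0 : 'I_1)).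
Local Notation t := (@rshift 1 n).

Definition dx H (u : 'rV[R]_(1 + n)) : 'M[R]_n :=
  \matrix_(a, b) partial o (fun w => H w a b) u.

(* Christoffel symbols, Ricci tensor and scalar curvature of the metrics
   [H (x, .)] on the slices [x = const]. *)
Definition tchristoffel H (k i j : 'I_n) (u : 'rV[R]_(1 + n)) : R :=
  2^-1 * \sum_(l < n) invmx (H u) k l *
    (partial (t i) (fun w => H w j l) u + partial (t j) (fun w => H w i l) u
     - partial (t l) (fun w => H w i j) u).

Definition tricci H (j k : 'I_n) (u : 'rV[R]_(1 + n)) : R :=
  \sum_(i < n) (partial (t i) (tchristoffel H i j k) u
    - partial (t j) (tchristoffel H i i k) u +
    \sum_(m < n) (tchristoffel H i i m u * tchristoffel H m j k u -
                  tchristoffel H i j m u * tchristoffel H m i k u)).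

Definition tscal H (u : 'rV[R]_(1 + n)) : R :=
  \sum_(j < n) \sum_(k < n) invmx (H u) j k * tricci H j k u.

(* The Christoffel symbols [Gamma^k_(x j)] of [dx^2 + K], i.e. up to sign the
   shape operator of the slices. *)
Definition shape K (u : 'rV[R]_(1 + n)) : 'M[R]_n :=
  2^-1 *: (invmx (K u) *m dx K u).

Section BlockMetric.
Variables (N : set 'rV[R]_(1 + n)) (G : 'rV[R]_(1 + n) -> 'M[R]_(1 + n)).
Variable K : 'rV[R]_(1 + n) -> 'M[R]_n.
Hypothesis oN : open N.
Hypothesis GE : forall w, N w -> G w = block_mx 1%:M 0 0 (K w).
Hypothesis K_unit : forall w, N w -> K w \in unitmx.
Hypothesis K_sym : forall w, N w -> (K w)^T = K w.
Hypothesis K_derivable : forall a b w, N w ->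
  derivable (fun v => dx K v a b) w (delta_mx 0 o).

Lemma block_oo w : N w -> G w o o = 1.
Proof. by move=> /GE ->; rewrite block_mxEul mxE. Qed.
Lemma block_ot w a : N w -> G w o (t a) = 0.
Proof. by move=> /GE ->; rewrite block_mxEur mxE. Qed.
Lemma block_to w a : N w -> G w (t a) o = 0.
Proof. by move=> /GE ->; rewrite block_mxEdl mxE. Qed.
Lemma block_tt w a b : N w -> G w (t a) (t b) = K w a b.
Proof. by move=> /GE ->; rewrite block_mxEdr. Qed.

Lemma invmx_block w : N w -> invmx (G w) = block_mx 1%:M 0 0 (invmx (K w)).
Proof.
move=> Nw; rewrite GE// invmx_block_diag ?invmx1//.
by rewrite unitmxE det_ublock det1 mul1r -unitmxE K_unit.
Qed.

Lemma inv_oo w : N w -> invmx (G w) o o = 1.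
Proof. by move=> /invmx_block ->; rewrite block_mxEul mxE. Qed.
Lemma inv_ot w a : N w -> invmx (G w) o (t a) = 0.
Proof. by move=> /invmx_block ->; rewrite block_mxEur mxE. Qed.
Lemma inv_to w a : N w -> invmx (G w) (t a) o = 0.
Proof. by move=> /invmx_block ->; rewrite block_mxEdl mxE. Qed.
Lemma inv_tt w a b : N w -> invmx (G w) (t a) (t b) = invmx (K w) a b.
Proof. by move=> /invmx_block ->; rewrite block_mxEdr. Qed.

Lemma partial_block_oo c w : N w -> partial c (fun w => G w o o) w = 0.
Proof.
by move=> Nw; rewrite -(partial_cst 1 c w); apply: eq_partial Nw => // ? /block_oo.
Qed.
Lemma partial_block_ot c a w : N w -> partial c (fun w => G w o (t a)) w = 0.
Proof.
by move=> Nw; rewrite -(partial_cst 0 c w); apply: eq_partial Nw => // ? /block_ot.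
Qed.
Lemma partial_block_to c a w : N w -> partial c (fun w => G w (t a) o) w = 0.
Proof.
by move=> Nw; rewrite -(partial_cst 0 c w); apply: eq_partial Nw => // ? /block_to.
Qed.
Lemma partial_block_tt c a b w : N w ->
  partial c (fun w => G w (t a) (t b)) w = partial c (fun w => K w a b) w.
Proof. by move=> Nw; apply: eq_partial Nw => // ? /block_tt. Qed.
Definition partial_blockE :=
  (partial_block_oo, partial_block_ot, partial_block_to, partial_block_tt).

Lemma dx_sym w : N w -> (dx K w)^T = dx K w.
Proof.
move=> Nw; apply/matrixP => a b; rewrite !mxE.
by apply: eq_partial Nw => // v Nv; rewrite -{1}(K_sym Nv) mxE.
Qed.

(** All entries of [G] with an index [o] are constant. This kills the symbols here, in
    [christoffel_oot] and in [christoffel_too]: the x-lines are unit speed geodesics orthogonal to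
    the slices. *)
Lemma christoffel_oto k w : N w -> christoffel G o o k w = 0.
Proof.
move=> Nw; rewrite /christoffel big_split_ord big_ord1/= big1 ?addr0; last first.
  by move=> l _; rewrite inv_ot// mul0r.
by case: (split_ordP k) => j ->; rewrite ?ord1 !partial_blockE// !(addr0,subr0,mulr0).
Qed.

Lemma christoffel_oot k w : N w -> christoffel G o k o w = 0.
Proof.
move=> Nw; rewrite /christoffel big_split_ord big_ord1/= big1 ?addr0; last first.
  by move=> l _; rewrite inv_ot// mul0r.
by case: (split_ordP k) => j ->; rewrite ?ord1 !partial_blockE// !(addr0,subr0,mulr0).
Qed.

(** This symbol is the second fundamental form of the slices with respect to the unit normal along
    x. *)
Lemma christoffel_ott a b w : N w ->
  christoffel G o (t a) (t b) w = - 2^-1 * dx K w a b.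
Proof.
move=> Nw; rewrite /christoffel big_split_ord big_ord1/= big1 ?addr0; last first.
  by move=> l _; rewrite inv_ot// mul0r.
by rewrite inv_oo// !partial_blockE// mxE !add0r mul1r mulrN mulNr.
Qed.

Lemma christoffel_too a w : N w -> christoffel G (t a) o o w = 0.
Proof.
move=> Nw; rewrite /christoffel big_split_ord big_ord1/= big1 ?addr0; last first.
  by move=> l _; rewrite !partial_blockE// !(addr0,subr0,mulr0).
by rewrite inv_to// !(mul0r,mulr0).
Qed.

Lemma christoffel_tot a b w : N w -> christoffel G (t a) o (t b) w = shape K w a b.
Proof.
move=> Nw; rewrite /christoffel big_split_ord big_ord1/= inv_to// mul0r add0r.
rewrite !mxE; congr (_ * _); apply: eq_bigr => l _.
by rewrite !partial_blockE// inv_tt// -(dx_sym Nw) !mxE addr0 subr0.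
Qed.

Lemma christoffel_tto a b w : N w -> christoffel G (t a) (t b) o w = shape K w a b.
Proof.
move=> Nw; rewrite /christoffel big_split_ord big_ord1/= inv_to// mul0r add0r.
rewrite !mxE; congr (_ * _); apply: eq_bigr => l _.
by rewrite !partial_blockE// inv_tt// -(dx_sym Nw) !mxE add0r subr0.
Qed.

Lemma christoffel_ttt a b c w : N w ->
  christoffel G (t a) (t b) (t c) w = tchristoffel K a b c w.
Proof.
move=> Nw; rewrite /christoffel big_split_ord big_ord1/= inv_to// mul0r add0r.
congr (_ * _); apply: eq_bigr => l _.
by rewrite !partial_blockE// inv_tt.
Qed.

Definition christoffelE := (christoffel_oto, christoffel_oot, christoffel_ott,
  christoffel_too, christoffel_tot, christoffel_tto, christoffel_ttt).

(** The trace of the Riccati equation for the shape operator: as the x-lines are geodesics, only its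
    x-derivative and its square survive. *)
Lemma ricci_oo w : N w ->
  ricci G o o w = - \tr (dx (shape K) w) - \tr (shape K w *m shape K w).
Proof.
move=> Nw; rewrite /ricci big_split_ord big_ord1/=.
rewrite {1}/riemann subrr add0r big1 ?add0r; last first.
  by move=> m _; rewrite subrr.
rewrite /mxtrace -!sumrN -big_split/=; apply: eq_bigr => a _.
rewrite /riemann (@eq_partial _ _ N (christoffel G (t a) o o) (fun=> 0))//;
  last by move=> v; exact: christoffel_too.
rewrite partial_cst.
rewrite (@eq_partial _ _ N (christoffel G (t a) (t a) o)
  (fun v => shape K v a a))//; last by move=> v; exact: christoffel_tto.
rewrite big_split_ord big_ord1/= !christoffelE// !mul0r !mulr0 subrr !add0r.
rewrite mxE; congr (_ + _); rewrite mxE -sumrN; apply: eq_bigr => b _.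
by rewrite !christoffelE// mulr0 sub0r.
Qed.

(** A contracted Gauss equation: the summand of index [o] is the curvature in the normal direction,
    and the others give the intrinsic Ricci tensor plus terms quadratic in the x-derivative of
    [K]. *)
Lemma ricci_tt a b w : N w ->
  ricci G (t a) (t b) w = tricci K a b w
    - 2^-1 * dx (dx K) w a b - 2^-1 * \tr (shape K w) * dx K w a b
    + 2^-1 * (dx K w *m shape K w) a b + 2^-1 * (dx K w *m shape K w) b a.
Proof.
move=> Nw; rewrite /ricci big_split_ord big_ord1/=.
have -> : riemann G o (t b) o (t a) w =
    - 2^-1 * dx (dx K) w a b + 2^-1 * (dx K w *m shape K w) a b.
  rewrite /riemann (@eq_partial _ _ N (christoffel G o o (t b)) (fun=> 0))//;
    last by move=> v; exact: christoffel_oto.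
  rewrite partial_cst subr0; congr (_ + _).
    rewrite (@eq_partial _ _ N _ (fun v => - 2^-1 * dx K v a b))//;
      last by move=> v; exact: christoffel_ott.
    by rewrite partialZ ?mxE//; exact: K_derivable.
  rewrite big_split_ord big_ord1/= !christoffelE// !mul0r subrr add0r.
  rewrite mxE mulr_sumr; apply: eq_bigr => c _.
  by rewrite !christoffelE//; ring.
have E (i : 'I_n) : riemann G (t i) (t b) (t i) (t a) w =
   (partial (t i) (tchristoffel K i a b) w
    - partial (t a) (tchristoffel K i i b) w +
    \sum_(m < n) (tchristoffel K i i m w * tchristoffel K m a b w -
                  tchristoffel K i a m w * tchristoffel K m i b w))
   + (- 2^-1 * shape K w i i * dx K w a b + 2^-1 * (dx K w b i * shape K w i a)).
  rewrite /riemann (@eq_partial _ _ N (christoffel G (t i) (t a) (t b))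
      (tchristoffel K i a b))//; last by move=> v; exact: christoffel_ttt.
  rewrite (@eq_partial _ _ N (christoffel G (t i) (t i) (t b))
      (tchristoffel K i i b))//; last by move=> v; exact: christoffel_ttt.
  rewrite -!addrA; congr (_ + (_ + _)).
  (* In the sum of products of Christoffel symbols, the middle index [o] yields the extrinsic terms
     and the tangential ones the intrinsic curvature. *)
  rewrite big_split_ord big_ord1/= !christoffelE// addrC; congr (_ + _).
    by apply: eq_bigr => m _; rewrite !christoffelE.
  have -> : dx K w i b = dx K w b i by rewrite -{1}(dx_sym Nw) mxE.
  by ring.
rewrite (eq_bigr _ (fun i _ => E i)) big_split/= -/(tricci K a b w) big_split/=.
rewrite -mulr_suml -!mulr_sumr -/(mxtrace _).
rewrite [(dx K w *m shape K w) b a]mxE.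
by ring.
Qed.

Lemma scal_block w : N w ->
  scal G w = tscal K w - \tr (dx (shape K) w) - \tr (shape K w *m shape K w)
   - 2^-1 * \tr (invmx (K w) *m dx (dx K) w)
   - 2^-1 * \tr (shape K w) * \tr (invmx (K w) *m dx K w)
   + \tr (invmx (K w) *m dx K w *m shape K w).
Proof.
move=> Nw; rewrite /scal big_split_ord big_ord1/= big_split_ord big_ord1/=.
rewrite inv_oo// mul1r ricci_oo// big1 ?addr0; last first.
  by move=> k _; rewrite inv_ot// mul0r.
(* By symmetry of the inverse, contracting with a matrix or with its transpose gives the same trace,
   so the last two terms of [ricci_tt] merge. *)
have W_sym : (invmx (K w))^T = invmx (K w) by rewrite trmx_inv K_sym.
have trW (B : 'M[R]_n) : \sum_a \sum_b invmx (K w) a b * B a b =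
    \tr (invmx (K w) *m B).
  rewrite /mxtrace exchange_big/=; apply: eq_bigr => b _; rewrite mxE.
  by apply: eq_bigr => a _; rewrite -{1}W_sym mxE.
have trWt (B : 'M[R]_n) : \sum_a \sum_b invmx (K w) a b * B b a =
    \tr (invmx (K w) *m B).
  rewrite /mxtrace; apply: eq_bigr => b _; rewrite mxE.
  by apply: eq_bigr => a _.
have E (a : 'I_n) s : s = \tr (shape K w) ->
  \sum_b invmx (G w) (t a) (t b) * ricci G (t a) (t b) w =
  \sum_b invmx (K w) a b * tricci K a b w
  - 2^-1 * (\sum_b invmx (K w) a b * dx (dx K) w a b)
  - 2^-1 * s * (\sum_b invmx (K w) a b * dx K w a b)
  + 2^-1 * (\sum_b invmx (K w) a b * (dx K w *m shape K w) a b)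
  + 2^-1 * (\sum_b invmx (K w) a b * (dx K w *m shape K w) b a).
  move=> sE; rewrite !mulr_sumr -!sumrN -!big_split/=; apply: eq_bigr => b _.
  by rewrite inv_tt// ricci_tt// -sE; ring.
rewrite (eq_bigr (fun a => \sum_b invmx (G w) (t a) (t b) *
  ricci G (t a) (t b) w)); last first.
  by move=> a _; rewrite big_split_ord big_ord1/= inv_to// mul0r add0r.
rewrite (eq_bigr _ (fun a _ => E a _ erefl)) !big_split/= !sumrN -!mulr_sumr.
rewrite !trW !trWt -/(tscal K w) mulmxA.
by field.
Qed.

End BlockMetric.
End Tangential.

(** * Scalar curvature of dx^2 + phi(x) H(x, y) *)
Section WarpedMetric.
Variables (R : realType) (n : nat).

Local Notation o := (lshift n (ord0 : 'I_1)).
Local Notation t := (@rshift 1 n).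

(** The extrinsic part of the scalar curvature of [dx^2 + H]: it is what [tscal H] must be completed
    by when the factor [phi] is 1. *)
Definition bounded_part (H : 'rV[R]_(1 + n) -> 'M[R]_n) (w : 'rV[R]_(1 + n)) : R :=
  \tr (shape H w *m shape H w) - \tr (shape H w) ^+ 2
  - 2^-1 * \tr (invmx (H w) *m dx (dx H) w) - \tr (dx (shape H) w).

Section ScalarCurvature.
Variables (N : set 'rV[R]_(1 + n)) (G : 'rV[R]_(1 + n) -> 'M[R]_(1 + n)).
Variables (H : 'rV[R]_(1 + n) -> 'M[R]_n) (phi psi psi' : 'rV[R]_(1 + n) -> R).
Hypothesis oN : open N.
Hypothesis GE : forall w, N w -> G w = block_mx 1%:M 0 0 (phi w *: H w).
Hypothesis H_unit : forall w, N w -> H w \in unitmx.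
Hypothesis H_sym : forall w, N w -> (H w)^T = H w.
Hypothesis H_smooth : forall a b, smooth_on N (fun w => H w a b).
Hypothesis phi_neq0 : forall w, N w -> phi w != 0.
Hypothesis phi_x : forall w, N w -> is_derive w (delta_mx 0 o) phi (psi w * phi w).
Hypothesis phi_t : forall a w, N w -> is_derive w (delta_mx 0 (t a)) phi 0.
Hypothesis psi_x : forall w, N w -> is_derive w (delta_mx 0 o) psi (psi' w).

Let K w := phi w *: H w.

Let invK w : N w -> invmx (K w) = (phi w)^-1 *: invmx (H w).
Proof.
move=> Nw; rewrite invmxZ// -mul_scalar_mx unitmx_mul H_unit// andbT.
by rewrite unitmxE det_scalar unitrX// unitfE phi_neq0.
Qed.

Let dH_smooth a b : smooth_on N (fun w => dx H w a b).
Proof.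
by apply: (eq_smooth oN _ (smooth_partial o (H_smooth a b))) => v _; rewrite mxE.
Qed.

Let dphi w : N w -> derivable phi w (delta_mx 0 o).
Proof. by case/phi_x. Qed.

Let dpsi w : N w -> derivable psi w (delta_mx 0 o).
Proof. by case/psi_x. Qed.

Let phi_xE w : N w -> partial o phi w = psi w * phi w.
Proof. by case/phi_x. Qed.

Let psi_xE w : N w -> partial o psi w = psi' w.
Proof. by case/psi_x. Qed.

(** The factor [phi] stays in front in order to cancel against the inverse of [K]. *)
Let dxK w : N w -> dx K w = phi w *: (psi w *: H w + dx H w).
Proof.
move=> Nw; apply/matrixP => a b; rewrite mxE.
have E v : N v -> K v a b = phi v * H v a b by move=> _; rewrite mxE.
rewrite (eq_partial _ oN E Nw).
rewrite (partialM (dphi Nw) (smooth_derivable (H_smooth a b) Nw)) (phi_xE Nw).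
by rewrite !mxE; ring.
Qed.

Let partialK_t c a b w : N w ->
  partial (t c) (fun v => K v a b) w = phi w * partial (t c) (fun v => H v a b) w.
Proof.
move=> Nw; have [dphi_t ephi] := phi_t c Nw.
have E v : N v -> K v a b = phi v * H v a b by move=> _; rewrite mxE.
rewrite (eq_partial _ oN E Nw).
rewrite (partialM dphi_t (smooth_derivable (H_smooth a b) Nw)).
by rewrite [partial (t c) phi w]ephi mulr0 addr0.
Qed.

Let dpsiH a b w : N w ->
  derivable (fun v => psi v * H v a b) w (delta_mx 0 o).
Proof.
move=> Nw.
exact: (derivable_mul (dpsi Nw) (smooth_derivable (H_smooth a b) Nw)).
Qed.

Let dpsiHD a b w : N w ->
  derivable (fun v => psi v * H v a b + dx H v a b) w (delta_mx 0 o).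
Proof.
move=> Nw.
exact: (derivable_add (@dpsiH a b w Nw) (smooth_derivable (dH_smooth a b) Nw)).
Qed.

Let dxKE a b v : N v ->
  dx K v a b = phi v * (psi v * H v a b + dx H v a b).
Proof. by move=> Nv; rewrite (dxK Nv) !mxE. Qed.

(** The coefficient [psi ^+ 2 + psi'] is the second x-derivative of [phi] divided by [phi]. *)
Let dxdxK w : N w -> dx (dx K) w = phi w *:
  ((psi w ^+ 2 + psi' w) *: H w + (2 * psi w) *: dx H w + dx (dx H) w).
Proof.
move=> Nw; apply/matrixP => a b; rewrite mxE.
rewrite (eq_partial _ oN (@dxKE a b) Nw) (partialM (dphi Nw) (@dpsiHD a b w Nw)).
rewrite (partialD (@dpsiH a b w Nw) (smooth_derivable (dH_smooth a b) Nw)).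
rewrite (partialM (dpsi Nw) (smooth_derivable (H_smooth a b) Nw)).
by rewrite (phi_xE Nw) (psi_xE Nw) !mxE; ring.
Qed.

Let K_derivable a b w : N w -> derivable (fun v => dx K v a b) w (delta_mx 0 o).
Proof.
move=> Nw; apply: near_eq_derivable (derivable_mul (dphi Nw) (@dpsiHD a b w Nw)).
by apply: (open_near_eq oN _ Nw) => v Nv; rewrite (dxKE a b Nv).
Qed.

(** Rescaling by a function of x alone changes the shape operator by an umbilical term only. *)
Let shapeK w : N w -> shape K w = (2^-1 * psi w)%:M + shape H w.
Proof.
move=> Nw; rewrite /shape invK// dxK// -scalemxAl -scalemxAr.
rewrite [(phi w)^-1 *: _]scalerA mulVf ?phi_neq0// scale1r mulmxDr.
by rewrite -scalemxAr mulVmx ?H_unit// scalerDr scalerA scalemx1.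
Qed.

Hypothesis shape_smooth : forall a b, smooth_on N (fun w => shape H w a b).

Let dx_shapeK w : N w -> dx (shape K) w = (2^-1 * psi' w)%:M + dx (shape H) w.
Proof.
move=> Nw; apply/matrixP => a b; rewrite mxE.
have E v : N v -> shape K v a b = 2^-1 * (a == b)%:R * psi v + shape H v a b.
  move=> Nv; rewrite (shapeK Nv) [LHS]mxE; congr (_ + _).
  by rewrite mxE -[LHS]mulr_natr mulrAC.
have dS := smooth_derivable (shape_smooth a b) Nw.
rewrite (eq_partial _ oN E Nw) (partialD _ (dS o)); last exact: derivableZ (dpsi Nw).
rewrite (partialZ _ (dpsi Nw)) (psi_xE Nw) [RHS]mxE.
by congr (_ + _); rewrite mxE// -[RHS]mulr_natr mulrAC.
Qed.

(** On each slice [phi] is constant, so [K] and [H] are homothetic: they share connection and Ricci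
    tensor, and the scalar curvature scales by the inverse of [phi]. *)
Let tchristoffelK a b c w : N w -> tchristoffel K a b c w = tchristoffel H a b c w.
Proof.
move=> Nw; rewrite /tchristoffel; congr (_ * _); apply: eq_bigr => l _.
rewrite invK// mxE !partialK_t//; have := phi_neq0 Nw; move=> p0.
by field.
Qed.

Let tscalK w : N w -> tscal K w = (phi w)^-1 * tscal H w.
Proof.
move=> Nw; rewrite /tscal mulr_sumr; apply: eq_bigr => j _.
rewrite mulr_sumr; apply: eq_bigr => k _.
rewrite (invK Nw) mxE -mulrA; congr (_ * (_ * _)).
rewrite /tricci; apply: eq_bigr => i _.
rewrite (eq_partial _ oN (@tchristoffelK i j k) Nw).
rewrite (eq_partial _ oN (@tchristoffelK i i k) Nw); congr (_ + _).
by apply: eq_bigr => m _; rewrite !(tchristoffelK _ _ _ Nw).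
Qed.

Lemma scal_warped w : N w ->
  scal G w = - n%:R * psi' w - (n%:R + n%:R ^+ 2) / 4 * psi w ^+ 2
    - (1 + n%:R) * psi w * \tr (shape H w) + bounded_part H w
    + (phi w)^-1 * tscal H w.
Proof.
move=> Nw.
have K_unit v : N v -> K v \in unitmx.
  move=> Nv; rewrite /K -mul_scalar_mx unitmx_mul H_unit// andbT.
  by rewrite unitmxE det_scalar unitrX// unitfE phi_neq0.
have K_sym v : N v -> (K v)^T = K v.
  by move=> Nv; rewrite /K linearZ/= H_sym.
rewrite (scal_block oN GE K_unit K_sym K_derivable Nw).
have trWH' : \tr (invmx (H w) *m dx H w) = 2 * \tr (shape H w).
  by rewrite /shape linearZ/= mulrA divff ?mul1r// pnatr_eq0.
have KK' : invmx (K w) *m dx K w = 2 *: shape K w.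
  by rewrite /shape scalerA divff ?scale1r// pnatr_eq0.
have KK'' : \tr (invmx (K w) *m dx (dx K) w) = n%:R * (psi w ^+ 2 + psi' w)
    + 4 * psi w * \tr (shape H w) + \tr (invmx (H w) *m dx (dx H) w).
  rewrite invK// dxdxK// -scalemxAl -scalemxAr scalerA mulVf ?phi_neq0//.
  rewrite scale1r !mulmxDr -!scalemxAr mulVmx ?H_unit// !raddfD/= !linearZ/=.
  by rewrite mxtrace1 trWH'; field.
have trB2 : \tr (shape K w *m shape K w) = n%:R / 4 * psi w ^+ 2
    + psi w * \tr (shape H w) + \tr (shape H w *m shape H w).
  rewrite shapeK// mulmxDl !mulmxDr !mul_scalar_mx mul_mx_scalar !raddfD/=.
  by rewrite -scalemx1 !linearZ/= mxtrace1; field.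
have trB : \tr (shape K w) = n%:R / 2 * psi w + \tr (shape H w).
  by rewrite (shapeK Nw) raddfD/= mxtrace_scalar -mulr_natr; field.
rewrite KK' KK'' (tscalK Nw) (dx_shapeK Nw) raddfD/= mxtrace_scalar -[_ *+ n]mulr_natr.
rewrite /bounded_part; move: trB2 trB.
move: (shape K w) (shape H w) (phi_neq0 Nw) => SK SH phi0 trB2 trB.
(* The coefficients add up as [- n/2 - n/2] for [psi'], [n/4 - n^2/4 - n/2] for [psi^2], and
   [1 - n - 2] for [psi] times the trace of [shape H]. *)
by rewrite -scalemxAl !mxtraceZ trB2 trB; field.
Qed.

End ScalarCurvature.

(** * Smoothness of the coefficients built from [H] *)

Section Smoothness.
Variables (U : set 'rV[R]_(1 + n)) (H : 'rV[R]_(1 + n) -> 'M[R]_n).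
Hypothesis oU : open U.
Hypothesis H_unit : forall w, U w -> H w \in unitmx.
Hypothesis H_smooth : forall a b, smooth_on U (fun w => H w a b).

Lemma smooth_dx (A : 'rV[R]_(1 + n) -> 'M[R]_n) a b :
  (forall a b, smooth_on U (fun w => A w a b)) ->
  smooth_on U (fun w => dx A w a b).
Proof.
move=> sA; apply: (eq_smooth oU _ (smooth_partial o (sA a b))) => w _.
by rewrite mxE.
Qed.

Lemma smooth_mulmx (A B : 'rV[R]_(1 + n) -> 'M[R]_n) a b :
  (forall a b, smooth_on U (fun w => A w a b)) ->
  (forall a b, smooth_on U (fun w => B w a b)) ->
  smooth_on U (fun w => (A w *m B w) a b).
Proof.
move=> sA sB.
apply: (eq_smooth (f := fun w => \sum_c A w a c * B w c b)) => //.
  by move=> w _; rewrite mxE.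
by apply: smooth_sum => // c; exact: smoothM.
Qed.

Lemma smooth_mxtrace (A : 'rV[R]_(1 + n) -> 'M[R]_n) :
  (forall a b, smooth_on U (fun w => A w a b)) ->
  smooth_on U (fun w => \tr (A w)).
Proof. by move=> sA; exact: smooth_sum. Qed.

Lemma smooth_shape a b : smooth_on U (fun w => shape H w a b).
Proof.
apply: (eq_smooth (f := fun w => 2^-1 * (invmx (H w) *m dx H w) a b)) => //.
  by move=> w _; rewrite [RHS]mxE.
apply: smoothM => //; first exact: smooth_cst.
apply: smooth_mulmx => ? ?; first exact: smooth_invmx.
exact: smooth_dx.
Qed.

Lemma smooth_bounded_part : smooth_on U (bounded_part H).
Proof.
have sS := smooth_shape.
apply: smoothD => //; last first.
  by apply: smoothN => //; apply: smooth_mxtrace => ? ?; exact: smooth_dx.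
apply: smoothD => //; last first.
  apply: smoothN => //; apply: smoothM => //; first exact: smooth_cst.
  apply: smooth_mxtrace => ? ?; apply: smooth_mulmx => ? ?.
    exact: smooth_invmx.
  by apply: smooth_dx => ? ?; exact: smooth_dx.
apply: smoothD => //.
  by apply: smooth_mxtrace => ? ?; exact: smooth_mulmx.
by apply: smoothN => //; apply: smoothM => //; exact: smooth_mxtrace.
Qed.

Lemma smooth_tchristoffel k i j : smooth_on U (tchristoffel H k i j).
Proof.
apply: smoothM => //; first exact: smooth_cst.
apply: smooth_sum => // l; apply: smoothM => //; first exact: smooth_invmx.
apply: smoothD => //; first by apply: smoothD => //; exact: smooth_partial.
by apply: smoothN => //; exact: smooth_partial.
Qed.

Lemma smooth_tscal : smooth_on U (tscal H).
Proof.
have sC := smooth_tchristoffel.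
apply: smooth_sum => // j; apply: smooth_sum => // k.
apply: smoothM => //; first exact: smooth_invmx.
apply: smooth_sum => // i; apply: smoothD => //.
  apply: smoothD => //; first exact: smooth_partial.
  by apply: smoothN => //; exact: smooth_partial.
apply: smooth_sum => // m; apply: smoothD => //; first exact: smoothM.
by apply: smoothN => //; exact: smoothM.
Qed.

End Smoothness.

End WarpedMetric.

(** * Asymptotics in a tube *)
Section PowerDerivatives.
Variable R : realType.

(** The factor [a / x] carries the sign of the derivative of [|x|], so one formula serves both sides
    of 0. *)
Lemma is_derive_norm_powR (a x : R) : x != 0 ->
  is_derive x (1 : R) (fun y : R => `|y| `^ a) (a / x * `|x| `^ a).
Proof.
move=> x0; have [xlt0|xgt0|xE] := ltgtP x 0; last by rewrite xE eqxx in x0.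
  have Nx0 : 0 < - x by rewrite oppr_gt0.
  have D : is_derive x (1 : R) (fun y : R => (- y) `^ a) (- (a * (- x) `^ (a - 1))).
    rewrite -[X in is_derive _ _ _ X]mulrN1.
    apply: (is_derive1_comp (f := fun y : R => y `^ a) (g := -%R)).
    exact: is_derive1_powR.
  apply: (near_eq_is_derive _ (is_derive_eq D _)).
    by near=> y; rewrite ltr0_norm//; near: y; exact: lt_nbhsl.
  rewrite ltr0_norm// powRB; last by rewrite (gt_eqF Nx0) implybT.
  by rewrite powRr1 ?ltW// invrN !mulrN opprK mulrAC mulrA.
have D := is_derive1_powR a xgt0.
apply: (near_eq_is_derive _ (is_derive_eq D _)).
  by near=> y; rewrite gtr0_norm//; near: y; exact: lt_nbhsr.
rewrite gtr0_norm// powRB; last by rewrite (gt_eqF xgt0) implybT.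
by rewrite powRr1 ?ltW// mulrAC mulrA.
Unshelve. all: by end_near. Qed.

Lemma is_derive_divr (a x : R) : x != 0 ->
  is_derive x (1 : R) (fun y : R => a / y) (- a / x ^+ 2).
Proof.
move=> x0; have did : derivable (id : R -> R) x 1 by exact: derivable_id.
have dV : derivable (fun y : R => y^-1) x 1 by exact: derivableV did.
split; first exact: derivableZ dV.
have -> : 'D_1 (fun y : R => a / y) x = a * 'D_1 (fun y : R => y^-1) x.
  exact: deriveZ dV.
have -> : 'D_1 (fun y : R => y^-1) x = - x ^- 2.
  by rewrite (deriveV x0 did) derive_id /GRing.scale/= mulr1.
by rewrite mulrN mulNr.
Qed.

(** The exponent will be [p = 2 alpha + 2], which is positive exactly when [alpha > -1]. *)
Lemma remainder_lt (M c p e : R) : 0 < p -> 0 < e ->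
  \forall x \near (0 : R)^', M * (c * `|x| + `|x| ^+ 2 + `|x| `^ p) < e.
Proof.
move=> p0 e0.
have : M * (c * a + a ^+ 2 + a `^ p) @[a --> (0 : R)^'+] -->
    M * (c * 0 + 0 ^+ 2 + 0).
  have id0 : a @[a --> (0 : R)^'+] --> (0 : R) by exact: cvg_within.
  apply: cvgM; first exact: cvg_cst.
  apply: cvgD; last exact: powR_cvg0.
  apply: cvgD; first by apply: cvgM id0; exact: cvg_cst.
  by rewrite expr2; under eq_fun do rewrite expr2; exact: cvgM.
rewrite expr0n/= !(mulr0, addr0) => H.
have : \forall a \near (0 : R)^'+, M * (c * a + a ^+ 2 + a `^ p) < e.
  by move/cvgrPdist_lt : H => /(_ e e0); apply: filterS => a;
    rewrite sub0r normrN; exact: le_lt_trans (ler_norm _).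
(* The expression depends on [|x|] only, so a radius valid to the right of 0 is valid on both
   sides. *)
rewrite !near_withinE => /nbhs_ballP[d /= d0 dP].
apply/nbhs_ballP; exists d => //= x; rewrite /ball/= sub0r normrN => xd x0.
by apply: dP; rewrite /ball/= ?sub0r ?normrN ?normr_id// normr_gt0.
Qed.

End PowerDerivatives.

(** * Convergence of row vectors *)

Section RowTopology.
Variable R : realType.

Lemma cvg_row (d : nat) (T : Type) (F : set_system T) (f : T -> 'rV[R]_d)
    (u : 'rV[R]_d) : Filter F ->
  (forall j, f x 0 j @[x --> F] --> u 0 j) -> f x @[x --> F] --> u.
Proof.
move=> FF cf A [P nP PA]; rewrite /nbhs/=.
have : \forall x \near F, forall j, P 0 j (f x 0 j).
  by apply: filter_forall => j; apply: cf; exact: nP.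
by apply: filterS => x Px; apply: PA => i j; rewrite ord1.
Qed.

Lemma rsubmx_continuous (n : nat) : continuous (fun u : 'rV[R]_(1 + n) => rsubmx u).
Proof.
move=> u; apply: (@cvg_row n _ (nbhs u)) => j; rewrite mxE; under eq_fun do rewrite mxE.
exact: coord_continuous.
Qed.

Lemma cvg_row_mx (n : nat) (T : Type) (F : set_system T) (f : T -> R)
    (g : T -> 'rV[R]_n) (x : R) (y : 'rV[R]_n) : Filter F ->
  f t @[t --> F] --> x -> g t @[t --> F] --> y ->
  row_mx (f t)%:M (g t) @[t --> F] --> (row_mx x%:M y : 'rV[R]_(1 + n)).
Proof.
move=> FF fx gy; apply: cvg_row => j; case: (split_ordP j) => k ->.
  rewrite row_mxEl mxE ord1; under eq_fun do rewrite row_mxEl mxE; exact: fx.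
rewrite row_mxEr; under eq_fun do rewrite row_mxEr.
apply: (cvg_comp g (fun v : 'rV[R]_n => v 0 k) gy).
exact: coord_continuous.
Qed.

End RowTopology.

(** The quadratic form vanishes on every vector of the kernel. *)
Lemma posdef_unitmx (R : realFieldType) (n : nat) (A : 'M[R]_n) :
  (forall v : 'rV[R]_n, v != 0 -> 0 < (v *m A *m v^T) 0 0) -> A \in unitmx.
Proof.
move=> Apos; rewrite -row_free_unit -kermx_eq0.
apply: contraT => /rowV0Pn[v /sub_kermxP vA v0].
by have := Apos v v0; rewrite vA mul0mx mxE ltxx.
Qed.

(** * The metric and its curvature in tube coordinates *)

Section GrushinCoordinates.
Variables (R : realType) (n : nat) (alpha : R) (X : grushinManifold n alpha).
Variable b : chart R n (singular X).
Hypothesis ab : atlas (singular X) b.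

Local Notation o := (lshift n (ord0 : 'I_1)).

(** This is the [H] of the warped form, with [u] standing for the tube coordinates (x, y). *)
Definition slice_coord (u : 'rV[R]_(1 + n)) : 'M[R]_n :=
  slice (lsubmx u 0 0) b (param b (rsubmx u)).

(** The slice x = 0 is included: smoothness there bounds the coefficients near the singular set. *)
Definition tube_domain : set 'rV[R]_(1 + n) :=
  [set u | `|lsubmx u 0 0| < Defs.radius X /\ chart_image b (rsubmx u)].

Lemma lsubmx00 (u : 'rV[R]_(1 + n)) : lsubmx u 0 0 = u 0 o.
Proof. by rewrite mxE. Qed.

Lemma open_tube_domain : open tube_domain.
Proof.
have -> : tube_domain =
    (fun u : 'rV[R]_(1 + n) => u 0 o) @^-1` [set x : R | `|x| < Defs.radius X] `&`
    (fun u : 'rV[R]_(1 + n) => rsubmx u) @^-1` chart_image b.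
  by apply/funext => u; rewrite /tube_domain /= lsubmx00.
apply: openI; apply: open_comp => [u _|].
- exact: coord_continuous.
- have -> : [set x : R | `|x| < Defs.radius X] = ball (0 : R) (Defs.radius X).
    by apply/funext => x; rewrite /ball/= sub0r normrN.
  by apply: ball_open; exact: Defs.radius_gt0.
- exact: rsubmx_continuous.
- exact: (@image_open _ _ _ b).
Qed.

Lemma open_punctured : open [set u : 'rV[R]_(1 + n) | u 0 o != 0 /\ tube_domain u].
Proof.
have -> : [set u : 'rV[R]_(1 + n) | u 0 o != 0 /\ tube_domain u] =
    (fun u : 'rV[R]_(1 + n) => u 0 o) @^-1` [set x : R | x != 0] `&` tube_domain.
  by [].
apply: openI; last exact: open_tube_domain.
by apply: open_comp => [u _|]; [exact: coord_continuous|exact: open_neq].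
Qed.

Lemma slice_coord_unit u : tube_domain u -> slice_coord u \in unitmx.
Proof.
move=> [ur [z bz zE]]; apply: posdef_unitmx.
have [+ _ _] := slice_riemannian ur.
by rewrite /slice_coord -zE coordK// => /(_ b z ab bz I)[].
Qed.

Lemma slice_coord_sym u : tube_domain u -> (slice_coord u)^T = slice_coord u.
Proof.
move=> [ur [z bz zE]].
have [+ _ _] := slice_riemannian ur.
by rewrite /slice_coord -zE coordK// => /(_ b z ab bz I)[].
Qed.

Lemma slice_coord_smooth i j : smooth_on tube_domain (fun u => slice_coord u i j).
Proof. exact: slice_smooth. Qed.

(** Here [psi = - 2 alpha / x] and [psi' = 2 alpha / x^2], so the first two terms of [scal_warped]
    are exactly the main term of the expansion. *)
Lemma scal_tube (S : ambient X -> R)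
    (hS : scalar_curvature (~` range (emb X)) (gmetric X) S) (x : R) z :
  x != 0 -> `|x| < Defs.radius X -> dom b z ->
  let w := row_mx x%:M (Defs.coord b z) in
  S (tube X x z) - - (alpha * n%:R * (alpha * n%:R + alpha + 2)) / x ^+ 2 =
    2 * alpha * (1 + n%:R) / x * \tr (shape slice_coord w)
    + bounded_part slice_coord w + `|x| `^ (2 * alpha) * tscal slice_coord w.
Proof.
move=> x0 xr bz w.
have [c ac [domc coordc]] := tube_diffeo ab.
have dct y z' : `|y| < Defs.radius X -> dom b z' -> dom c (tube X y z').
  by move=> yr bz'; rewrite domc; exists y, z'.
(* Singular points have the form [tube 0 z']; injectivity of the tube would force x = 0. *)
have nZ : (~` range (emb X)) (tube X x z).
  move=> [z' _]; rewrite -tube0 => /tube_inj[]//.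
    by rewrite normr0; exact: Defs.radius_gt0.
  by move=> /esym/eqP; rewrite (negbTE x0).
rewrite (hS c _ ac (dct _ _ xr bz) nZ) coordc//.
pose N : set 'rV[R]_(1 + n) := [set u : 'rV[R]_(1 + n) | u 0 o != 0 /\ tube_domain u].
have wo : w 0 o = x by rewrite row_mxEl mxE.
have Nw : N w.
  split; first by rewrite wo.
  split; first by rewrite lsubmx00 wo.
  by rewrite row_mxKr; exists z.
have oN : open N := open_punctured.
have NU u : N u -> tube_domain u by case.
have sub_smooth f : smooth_on tube_domain f -> smooth_on N f.
  exact: smooth_subset.
pose phi (u : 'rV[R]_(1 + n)) := `|u 0 o| `^ (- (2 * alpha)).
pose psi (u : 'rV[R]_(1 + n)) := - (2 * alpha) / u 0 o.
pose psi' (u : 'rV[R]_(1 + n)) := - - (2 * alpha) / u 0 o ^+ 2.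
have GE u : N u -> gmetric X c (param c u) =
    block_mx 1%:M 0 0 (phi u *: slice_coord u).
  move=> [u0 [ur [z' bz' z'E]]]; rewrite lsubmx00 in ur.
  (* Thus [u] is the coordinate vector of a tube point, and [param c] returns that point. *)
  have uE : u = row_mx (u 0 o)%:M (Defs.coord b z').
    by rewrite z'E -[LHS]hsubmxK [lsubmx u]mx11_scalar lsubmx00.
  rewrite {1}uE -coordc// coordK; last exact: dct.
  by rewrite (gmetric_tube ab ac (conj domc coordc))// /slice_coord -z'E coordK//
    lsubmx00.
have H_unit u : N u -> slice_coord u \in unitmx by move=> /NU /slice_coord_unit.
have H_sym u : N u -> (slice_coord u)^T = slice_coord u.
  by move=> /NU /slice_coord_sym.
have H_smooth i j : smooth_on N (fun u => slice_coord u i j).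
  by apply: sub_smooth; exact: slice_coord_smooth.
have phi_neq0 u : N u -> phi u != 0.
  by move=> [u0 _]; rewrite /phi gt_eqF// powR_gt0// normr_gt0.
have phi_x u : N u -> is_derive u (delta_mx 0 o) phi (psi u * phi u).
  by move=> [u0 _]; exact: is_derive_coord (is_derive_norm_powR _ u0).
have phi_t a u : N u -> is_derive u (delta_mx 0 (rshift 1 a)) phi 0.
  by move=> _; exact: (is_derive_coord_ne (fun y : R => `|y| `^ (- (2 * alpha)))).
have psi_x u : N u -> is_derive u (delta_mx 0 o) psi (psi' u).
  by move=> [u0 _]; exact: is_derive_coord (is_derive_divr _ u0).
have shape_smooth i j : smooth_on N (fun u => shape slice_coord u i j).
  apply: sub_smooth; apply: smooth_shape => //.
  + exact: open_tube_domain.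
  + exact: slice_coord_unit.
  + exact: slice_coord_smooth.
rewrite (scal_warped oN GE H_unit H_sym H_smooth phi_neq0 phi_x phi_t psi_x
  shape_smooth Nw).
rewrite /phi /psi /psi' wo powRN invrK.
move: (shape _ w) (bounded_part _ w) (tscal _ w) => B B0 T.
by field.
Qed.

End GrushinCoordinates.

(** * Estimate of the remainder, local and then uniform *)

Lemma near_norm_le (R : realType) (T : Type) (F : set_system T) (f : T -> R)
    (l : R) : Filter F ->
  f t @[t --> F] --> l -> \forall t \near F, `|f t| <= `|l| + 1.
Proof.
move=> FF /cvgrPdist_le/(_ 1 ltr01); apply: filterS => t lt.
by rewrite -[f t](subKr l) (le_trans (ler_normB _ _))// lerD2l.
Qed.

(** Multiplying by [x^2] turns the three weights [k / x], 1 and [|x|^a] into those of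
    [remainder_lt]. *)
Lemma remainder_le (R : realType) (a k x tr B T M e : R) : x != 0 ->
  `|tr| <= M -> `|B| <= M -> `|T| <= M ->
  M * (`|k| * `|x| + `|x| ^+ 2 + `|x| `^ (a + 2)) < e ->
  `|k / x * tr + B + `|x| `^ a * T| <= e * `|x| ^- 2.
Proof.
move=> x0 trM BM TM /ltW Me.
have nx0 : 0 < `|x| by rewrite normr_gt0.
rewrite ler_pdivlMr ?exprn_gt0//; apply: le_trans Me.
rewrite powRD ?(gt_eqF nx0) ?implybT// powR_mulrn//.
rewrite [leRHS](_ : _ = (`|k| / `|x| * M + M + `|x| `^ a * M) * `|x| ^+ 2);
  last by field; rewrite gt_eqF.
rewrite ler_pM2r ?exprn_gt0//.
apply: le_trans (ler_normD _ _) _; apply: lerD; last first.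
  by rewrite normrM ger0_norm ?powR_ge0// ler_wpM2l// powR_ge0.
apply: le_trans (ler_normD _ _) _; apply: lerD => //.
by rewrite normrM normrM normfV ler_wpM2l// divr_ge0.
Qed.

(** Near the point over [z0] on the slice x = 0, continuity bounds the three coefficients in
    [scal_tube]. The product form of the neighbourhood is the one that compactness can globalise. *)
Lemma scal_tube_near (R : realType) (n : nat) (alpha : R)
    (X : grushinManifold n alpha) (S : ambient X -> R) (z0 : singular X)
    (e : R) : -1 < alpha ->
  scalar_curvature (~` range (emb X)) (gmetric X) S -> 0 < e ->
  \forall z \near z0 & x \near (0 : R)^',
    `|S (tube X x z) - - (alpha * n%:R * (alpha * n%:R + alpha + 2)) / x ^+ 2|
      <= e * `|x| ^- 2.
Proof.
move=> alpha1 hS e0.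
have [b ab bz0] := atlas_cover z0.
pose w0 : 'rV[R]_(1 + n) := row_mx 0%:M (Defs.coord b z0).
have oU : open (tube_domain b) by exact: open_tube_domain.
have Uw0 : tube_domain b w0.
  split; last by rewrite row_mxKr; exists z0.
  by rewrite lsubmx00 row_mxEl mxE normr0; exact: Defs.radius_gt0.
pose F := filter_prod (nbhs z0) (0 : R)^'.
pose W (p : singular X * R) : 'rV[R]_(1 + n) := row_mx p.2%:M (Defs.coord b p.1).
(* The limit lies on the excluded slice x = 0, yet inside [tube_domain], where the coefficients are
   continuous. *)
have cW : W p @[p --> F] --> w0.
  apply: cvg_row_mx.
    by apply: (cvg_trans cvg_snd); exact: nbhs_dnbhs.
  by apply: (cvg_comp _ _ cvg_fst); exact: Defs.coord_continuous.
have bounded f : smooth_on (tube_domain b) f ->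
    \forall p \near F, `|f (W p)| <= `|f w0| + 1.
  move=> sf; apply: near_norm_le.
  exact: (cvg_comp _ _ cW (smooth_continuous sf Uw0)).
have H_unit w : tube_domain b w -> slice_coord b w \in unitmx.
  exact: slice_coord_unit.
have H_smooth := slice_coord_smooth ab.
have Hc := bounded _ (smooth_mxtrace oU (smooth_shape oU H_unit H_smooth)).
have HB := bounded _ (smooth_bounded_part oU H_unit H_smooth).
have HT := bounded _ (smooth_tscal oU H_unit H_smooth).
have p0 : 0 < 2 * alpha + 2 by lra.
set H := slice_coord b in Hc HB HT.
(* A common bound: each of the three local bounds is one of these absolute values plus 1. *)
pose M := `|\tr (shape H w0)| + `|bounded_part H w0| + `|tscal H w0| + 1.
have M1 : `|\tr (shape H w0)| + 1 <= M.
  by rewrite /M lerD2r -addrA lerDl addr_ge0.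
have M2 : `|bounded_part H w0| + 1 <= M.
  by rewrite /M lerD2r -addrA [leRHS]addrCA lerDl addr_ge0.
have M3 : `|tscal H w0| + 1 <= M by rewrite /M lerD2r lerDr addr_ge0.
pose c := `|2 * alpha * (1 + n%:R)|.
have nx (P : set R) : (\forall x \near (0 : R)^', P x) -> \forall p \near F, P p.2.
  by move=> Px; exact: cvg_snd Px.
have near_e := nx _ (remainder_lt M c p0 e0).
have near_0 : \forall p \near F, p.2 != 0.
  by apply: (nx (fun x => x != 0)); exact: nbhs_dnbhs_neq.
have near_r : \forall p \near F, `|p.2| < Defs.radius X.
  apply: (nx (fun x => `|x| < Defs.radius X)); apply: nbhs_dnbhs.
  apply/nbhs_ballP; exists (Defs.radius X); first exact: Defs.radius_gt0.
  by move=> x; rewrite /ball/= sub0r normrN.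
have near_b : \forall p \near F, dom b p.1.
  apply: cvg_fst; apply: open_nbhs_nbhs; split=> //; exact: dom_open.
have : \forall p \near F, `|S (tube X p.2 p.1) -
    - (alpha * n%:R * (alpha * n%:R + alpha + 2)) / p.2 ^+ 2|
      <= e * `|p.2| ^- 2.
  near=> p.
  have x0 : p.2 != 0 by near: p.
  rewrite (scal_tube ab hS x0); [|by near: p|by near: p].
  apply: (@remainder_le _ _ _ _ _ _ _ M) => //; last by near: p.
  - by apply: le_trans M1; near: p.
  - by apply: le_trans M2; near: p.
  - by apply: le_trans M3; near: p.
by [].
Unshelve. all: by end_near. Qed.

Theorem proposition1p3 (R : realType) (n : nat) (hn : (0 < n)%N) (alpha : R)
  (halpha : -1 < alpha) (X : grushinManifold n alpha)
  (hZ : compact [set: singular X])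
  (S : ambient X -> R)
  (hS : scalar_curvature (~` range (emb X)) (gmetric X) S) :
  (fun q : R * singular X => S (tube X q.1 q.2)) =
  (fun q : R * singular X =>
     - (alpha * n%:R * (alpha * n%:R + alpha + 2)) / q.1 ^+ 2)
  +o_ (near_singular X)
  (fun q : R * singular X => `|q.1| ^- 2).
Proof.
apply/eqaddoP => e e0.
(* Compactness in near-covering form: a property holding for x near 0 locally around each point of
   the singular set holds for x near 0 at all its points at once. *)
have /compact_near_coveringP cover := hZ.
have := cover R (0 : R)^' (fun x z =>
  `|S (tube X x z) - - (alpha * n%:R * (alpha * n%:R + alpha + 2)) / x ^+ 2|
    <= e * `|x| ^- 2) _ (fun z _ => @scal_tube_near R n alpha X S z e halpha hS e0).
(* The witness for the product filter is the set of x good for every z, times the whole singular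
   set. *)
move=> near_x; exists ([set x | [set: singular X] `<=` (fun z =>
  `|S (tube X x z) - - (alpha * n%:R * (alpha * n%:R + alpha + 2)) / x ^+ 2|
    <= e * `|x| ^- 2)], setT); first by split=> [|z _]; [exact: near_x|].
move=> [x z] [/= Px _].
by rewrite [`|_ ^- 2|]ger0_norm ?invr_ge0 ?exprn_ge0//; exact: Px.
Qed.
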